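(* There is a one-to-one correspondence between the irreducible $\mathcal{SD}$-modules and the irreducible $\mathcal{D}$-modules (up to isomorphism), given by $M\mapsto S(M)$ for $M$ an irreducible $\mathcal{D}$-module.
   Context: Everything is over $\mathbb{C}$. The Weyl algebra $\mathcal{D}$ is the associative algebra generated by $t^{\pm1}$ and $\partial_t$ subject to $\partial_t t-t\partial_t=1$. The Weyl superalgebra $\mathcal{SD}$ is the associative superalgebra generated by the even elements $t^{\pm1},\partial_t$ and the odd elements $\theta,\partial_\theta$, with $\partial_t t-t\partial_t=1$, $\partial_\theta\theta+\theta\partial_\theta=1$, $\theta^2=\partial_\theta^2=0$, and with $\theta,\partial_\theta$ commuting with $t^{\pm1},\partial_t$; thus $\mathcal{SD}$ is the tensor product of $\mathcal{D}$ with the four-dimensional Clifford superalgebra generated by $\theta,\partial_\theta$. Modules over $\mathcal{SD}$ are $\mathbb{Z}_2$-graded, irreducible means nonzero with no nonzero proper graded submodule, and isomorphisms of $\mathcal{SD}$-modules are linear bijections commuting with the action that are either even or odd (so modules differing only by a parity change are identified). For a $\mathcal{D}$-module $M$, $S(M)=M\oplus\overline M$, where $\overline M=\{\overline v\mid v\in M\}$ is a copy of $M$ ($M$ even, $\overline M$ odd), with the $\mathcal{D}$-action on $M$, $x\cdot\overline v=\overline{xv}$ for $x\in\mathcal{D}$, and $\partial_\theta\cdot v=0$, $\theta\cdot v=\overline v$, $\partial_\theta\cdot\overline v=v$, $\theta\cdot\overline v=0$ for $v\in M$. *)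

(* Defs.v *)
From HB Require Import structures.
From mathcomp Require Import all_boot all_order all_algebra.
From mathcomp Require Import generic_quotient boolp functions reals.
From mathcomp Require Import complex.

Set Implicit Arguments.
Unset Strict Implicit.
Unset Printing Implicit Defensive.

Import GRing.Theory.
Local Open Scope ring_scope.
Local Open Scope quotient_scope.

Section Presentation.
Variables (K : comNzRingType) (G : Type).

Inductive expr : Type :=
| Cst of K
| Gen of G
| Add of expr & expr
| Mul of expr & expr.

HB.instance Definition _ := gen_eqMixin expr.
HB.instance Definition _ := gen_choiceMixin expr.

Definition Opp x := Mul (Cst (-1)) x.

Variable rels : expr -> expr -> Prop.

(* Expressions modulo [cong] form the K-algebra presented by [rels]: [cong] is
   the least congruence containing [rels] and the axioms of (associative,
   unital) K-algebras. *)
Inductive cong : expr -> expr -> Prop :=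
| cong_rel x y : rels x y -> cong x y
| cong_refl x : cong x x
| cong_sym x y : cong x y -> cong y x
| cong_trans x y z : cong x y -> cong y z -> cong x z
| cong_add x x' y y' : cong x x' -> cong y y' -> cong (Add x y) (Add x' y')
| cong_mul x x' y y' : cong x x' -> cong y y' -> cong (Mul x y) (Mul x' y')
| cong_addA x y z : cong (Add x (Add y z)) (Add (Add x y) z)
| cong_addC x y : cong (Add x y) (Add y x)
| cong_add0 x : cong (Add (Cst 0) x) x
| cong_addN x : cong (Add (Opp x) x) (Cst 0)
| cong_mulA x y z : cong (Mul x (Mul y z)) (Mul (Mul x y) z)
| cong_mul1 x : cong (Mul (Cst 1) x) x
| cong_mulDl x y z : cong (Mul (Add x y) z) (Add (Mul x z) (Mul y z))
| cong_mulDr x y z : cong (Mul x (Add y z)) (Add (Mul x y) (Mul x z))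
| cong_cstD a b : cong (Cst (a + b)) (Add (Cst a) (Cst b))
| cong_cstM a b : cong (Cst (a * b)) (Mul (Cst a) (Cst b))
| cong_cstC a x : cong (Mul (Cst a) x) (Mul x (Cst a)).

Definition congb x y := `[< cong x y >].

Lemma congb_refl : reflexive congb.
Proof. by move=> x; apply/asboolP; apply: cong_refl. Qed.

Lemma congb_sym : symmetric congb.
Proof. by move=> x y; apply/asboolP/asboolP => /cong_sym. Qed.

Lemma congb_trans : transitive congb.
Proof.
by move=> y x z /asboolP xy /asboolP yz; apply/asboolP; apply: cong_trans yz.
Qed.

Canonical congb_equiv := EquivRel congb congb_refl congb_sym congb_trans.

Definition presented : Type := {eq_quot congb_equiv}.
HB.instance Definition _ := Choice.on presented.

Definition cls (x : expr) : presented := \pi_{eq_quot congb_equiv} x.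
Definition rep (x : presented) : expr :=
  repr (x : {eq_quot congb_equiv}).

Lemma repK x : cls (rep x) = x.
Proof. exact: reprK. Qed.

Lemma cls_eq x y : cls x = cls y <-> cong x y.
Proof.
by split=> [/eqmodP /asboolP //|xy]; apply/eqmodP; apply/asboolP.
Qed.

Lemma cong_rep x : cong (rep (cls x)) x.
Proof. by apply/cls_eq; rewrite repK. Qed.

Definition pcst (a : K) : presented := cls (Cst a).
Definition pgen (g : G) : presented := cls (Gen g).
Definition padd x y : presented := cls (Add (rep x) (rep y)).
Definition pmul x y : presented := cls (Mul (rep x) (rep y)).
Definition popp x : presented := cls (Opp (rep x)).

Lemma clsD x y : padd (cls x) (cls y) = cls (Add x y).
Proof. by apply/cls_eq; apply: cong_add; apply: cong_rep. Qed.

Lemma clsM x y : pmul (cls x) (cls y) = cls (Mul x y).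
Proof. by apply/cls_eq; apply: cong_mul; apply: cong_rep. Qed.

Lemma clsN x : popp (cls x) = cls (Opp x).
Proof. by apply/cls_eq; apply: cong_mul; [apply: cong_refl|apply: cong_rep]. Qed.

Lemma paddA : associative padd.
Proof.
move=> x y z; rewrite -(repK x) -(repK y) -(repK z) !clsD.
by apply/cls_eq; apply: cong_addA.
Qed.

Lemma paddC : commutative padd.
Proof.
by move=> x y; rewrite -(repK x) -(repK y) !clsD; apply/cls_eq/cong_addC.
Qed.

Lemma padd0 : left_id (pcst 0) padd.
Proof. by move=> x; rewrite -(repK x) clsD; apply/cls_eq/cong_add0. Qed.

Lemma paddN : left_inverse (pcst 0) popp padd.
Proof. by move=> x; rewrite -(repK x) clsN clsD; apply/cls_eq/cong_addN. Qed.

Lemma pmulA : associative pmul.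
Proof.
move=> x y z; rewrite -(repK x) -(repK y) -(repK z) !clsM.
by apply/cls_eq; apply: cong_mulA.
Qed.

Lemma pmul1 : left_id (pcst 1) pmul.
Proof. by move=> x; rewrite -(repK x) clsM; apply/cls_eq/cong_mul1. Qed.

Lemma pcstC a x : pmul (pcst a) x = pmul x (pcst a).
Proof. by rewrite -(repK x) !clsM; apply/cls_eq/cong_cstC. Qed.

Lemma pmulr1 : right_id (pcst 1) pmul.
Proof. by move=> x; rewrite -pcstC pmul1. Qed.

Lemma pmulDl : left_distributive pmul padd.
Proof.
move=> x y z; rewrite -(repK x) -(repK y) -(repK z) !(clsD, clsM).
by apply/cls_eq; apply: cong_mulDl.
Qed.

Lemma pmulDr : right_distributive pmul padd.
Proof.
move=> x y z; rewrite -(repK x) -(repK y) -(repK z) !(clsD, clsM).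
by apply/cls_eq; apply: cong_mulDr.
Qed.

HB.instance Definition _ := GRing.isPzRing.Build presented
  paddA paddC padd0 paddN pmulA pmul1 pmulr1 pmulDl pmulDr.

Definition pscale (a : K) (x : presented) : presented := pcst a * x.

Lemma pscaleA a b x : pscale a (pscale b x) = pscale (a * b) x.
Proof.
rewrite /pscale mulrA; congr (_ * _).
by rewrite [LHS]clsM; apply/esym/cls_eq/cong_cstM.
Qed.

Lemma pscale1 : left_id 1 pscale.
Proof. exact: mul1r. Qed.

Lemma pscaleDr : right_distributive pscale +%R.
Proof. by move=> a x y; apply: mulrDr. Qed.

Lemma pscaleDl x : {morph pscale^~ x : a b / a + b}.
Proof.
move=> a b; rewrite /pscale -mulrDl; congr (_ * _).
by rewrite [RHS]clsD; apply/cls_eq/cong_cstD.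
Qed.

HB.instance Definition _ := GRing.Zmodule_isLmodule.Build K presented
  pscaleA pscale1 pscaleDr pscaleDl.

Lemma pscalerAl (a : K) (x y : presented) : a *: (x * y) = (a *: x) * y.
Proof. exact: mulrA. Qed.

Lemma pscalerAr (a : K) (x y : presented) : a *: (x * y) = x * (a *: y).
Proof.
rewrite /GRing.scale /= /pscale !mulrA; congr (_ * _); exact: pcstC.
Qed.

(* Linear operators on [V] satisfying the relations make [V] a module. *)
Section Action.
Variables (V : lmodType K) (ops : G -> V -> V).

Fixpoint eval (x : expr) (v : V) : V :=
  match x with
  | Cst a => a *: v
  | Gen g => ops g v
  | Add y z => eval y v + eval z v
  | Mul y z => eval y (eval z v)
  end.

Definition pact (x : presented) (v : V) : V := eval (rep x) v.

Hypothesis ops_lin : forall g, linear (ops g).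
Hypothesis ops_rel : forall x y, rels x y -> eval x =1 eval y.

Lemma eval_lin x : linear (eval x).
Proof.
elim: x => [a|g|x IHx y IHy|x IHx y IHy] b u v /=.
- by rewrite scalerDr !scalerA mulrC.
- exact: ops_lin.
- by rewrite IHx IHy scalerDr addrACA.
- by rewrite IHy IHx.
Qed.

Lemma evalD x u v : eval x (u + v) = eval x u + eval x v.
Proof. by have := eval_lin x 1 u v; rewrite !scale1r. Qed.

Lemma evalZ x a v : eval x (a *: v) = a *: eval x v.
Proof.
have e0 : eval x 0 = 0.
  by apply: (addrI (eval x 0)); rewrite -evalD !addr0.
by have := eval_lin x a v 0; rewrite e0 !addr0.
Qed.

Lemma eval_cong x y : cong x y -> eval x =1 eval y.
Proof.
move=> xy; elim: x y / xy => //=.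
- by move=> x y _ IH v; rewrite IH.
- by move=> x y z _ IHx _ IHy v; rewrite IHx.
- by move=> x x' y y' _ IHx _ IHy v; rewrite IHx IHy.
- by move=> x x' y y' _ IHx _ IHy v; rewrite IHy IHx.
- by move=> x y z v; rewrite addrA.
- by move=> x y v; rewrite addrC.
- by move=> x v; rewrite scale0r add0r.
- by move=> x v; rewrite scaleN1r addNr scale0r.
- by move=> x v; rewrite scale1r.
- by move=> x y z v; rewrite evalD.
- by move=> a b v; rewrite scalerDl.
- by move=> a b v; rewrite scalerA.
- by move=> a x v; rewrite evalZ.
Qed.

Lemma pact_cls x v : pact (cls x) v = eval x v.
Proof. exact/eval_cong/cong_rep. Qed.

Lemma pactA x y v : pact x (pact y v) = pact (x * y) v.
Proof. by rewrite [in RHS]/GRing.mul /= /pmul [RHS]pact_cls. Qed.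

Lemma pact1 : left_id 1 pact.
Proof. by move=> v; rewrite [LHS]pact_cls /= scale1r. Qed.

Lemma pactDr : right_distributive pact +%R.
Proof. by move=> x u v; apply: evalD. Qed.

Lemma pactDl v : {morph pact^~ v : x y / x + y}.
Proof. by move=> x y /=; rewrite [in LHS]/GRing.add /= /padd [LHS]pact_cls. Qed.

Lemma pact_nontrivial (v : V) : v != 0 -> (1 : presented) != 0.
Proof.
move=> v0; apply: contra v0 => /eqP e10.
have := congr1 (pact^~ v) e10; rewrite pact1 [X in _ = X -> _]pact_cls /=.
by rewrite scale0r => ->.
Qed.

End Action.
End Presentation.

Arguments Cst {K G}.
Arguments Gen {K G}.
Arguments pgen {K G} rels.

Declare Scope expr_scope.
Delimit Scope expr_scope with expr.
Bind Scope expr_scope with expr.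
Notation "x + y" := (Add x y) : expr_scope.
Notation "- x" := (Opp x) : expr_scope.
Notation "x - y" := (Add x (Opp y)) : expr_scope.
Notation "x * y" := (Mul x y) : expr_scope.
Notation "1" := (Cst 1%R) : expr_scope.
Notation "0" := (Cst 0%R) : expr_scope.

Section Restriction.
Variables (K : comNzRingType) (A : algType K) (M : lmodType A).

Definition base_mod : Type := M.
HB.instance Definition _ := GRing.Zmodule.on base_mod.

Definition base_scale (a : K) (v : base_mod) : base_mod := (a%:A : A) *: (v : M).

Lemma base_scaleA a b v : base_scale a (base_scale b v) = base_scale (a * b) v.
Proof. by rewrite /base_scale scalerA -scalerAl mul1r scalerA. Qed.

Lemma base_scale1 : left_id 1 base_scale.
Proof. by move=> v; rewrite /base_scale !scale1r. Qed.

Lemma base_scaleDr : right_distributive base_scale +%R.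
Proof. by move=> a u v; apply: scalerDr. Qed.

Lemma base_scaleDl v : {morph base_scale^~ v : a b / a + b}.
Proof. by move=> a b; rewrite /base_scale !scalerDl. Qed.

HB.instance Definition _ := GRing.Zmodule_isLmodule.Build K base_mod
  base_scaleA base_scale1 base_scaleDr base_scaleDl.
End Restriction.

Inductive weyl_gen := WT | WTinv | WDt.

Inductive super_gen := Even of weyl_gen | Theta | DTheta.

Section Relations.
Variable K : comNzRingType.
Local Open Scope expr_scope.

Inductive weyl_rel : expr K weyl_gen -> expr K weyl_gen -> Prop :=
| weyl_ttinv : weyl_rel (Gen WT * Gen WTinv) 1
| weyl_tinvt : weyl_rel (Gen WTinv * Gen WT) 1
| weyl_dt : weyl_rel (Gen WDt * Gen WT - Gen WT * Gen WDt) 1.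

Local Notation t := (Gen (Even WT)).
Local Notation tinv := (Gen (Even WTinv)).
Local Notation dt := (Gen (Even WDt)).

Inductive super_rel : expr K super_gen -> expr K super_gen -> Prop :=
| super_ttinv : super_rel (t * tinv) 1
| super_tinvt : super_rel (tinv * t) 1
| super_dt : super_rel (dt * t - t * dt) 1
| super_dtheta : super_rel (Gen DTheta * Gen Theta + Gen Theta * Gen DTheta) 1
| super_theta2 : super_rel (Gen Theta * Gen Theta) 0
| super_dtheta2 : super_rel (Gen DTheta * Gen DTheta) 0
| super_theta_comm g :
    super_rel (Gen Theta * Gen (Even g)) (Gen (Even g) * Gen Theta)
| super_dtheta_comm g :
    super_rel (Gen DTheta * Gen (Even g)) (Gen (Even g) * Gen DTheta).

Definition weyl : Type := presented weyl_rel.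
HB.instance Definition _ := GRing.PzRing.on weyl.
HB.instance Definition _ := GRing.Lmodule.on weyl.

Definition sweyl : Type := presented super_rel.
HB.instance Definition _ := GRing.PzRing.on sweyl.
HB.instance Definition _ := GRing.Lmodule.on sweyl.

Fixpoint expr_even (e : expr K weyl_gen) : expr K super_gen :=
  match e with
  | Cst a => Cst a
  | Gen g => Gen (Even g)
  | Add x y => expr_even x + expr_even y
  | Mul x y => expr_even x * expr_even y
  end.

Definition weyl_incl (x : weyl) : sweyl :=
  cls super_rel (expr_even (rep (x : presented weyl_rel))).

End Relations.

(* The action on formal series [\sum_n f n t^n], n : int; it shows that the
   algebras are nonzero, as [algType] requires. *)
Section NonTrivial.
Variable K : comNzRingType.
Local Notation V := (int -> K^o).

Definition series_op (g : weyl_gen) (f : V) : V := fun n =>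
  match g with
  | WT => f (n - 1)
  | WTinv => f (n + 1)
  | WDt => (n + 1)%:~R * f (n + 1)
  end.

Lemma series_op_lin g : linear (series_op g).
Proof.
move=> a u v; apply/funext => n; case: g => //=.
by rewrite /series_op [in RHS]/GRing.add /= [in RHS]/GRing.scale /=
  /GRing.scale /= mulrDr mulrCA.
Qed.

Lemma series_op_rel x y :
  weyl_rel x y -> eval series_op x =1 eval series_op y.
Proof.
case=> f; apply/funext => n /=; rewrite scale1r //=.
- by rewrite /series_op subrK.
- by rewrite /series_op addrK.
- rewrite scaleN1r /series_op [LHS]/GRing.add /= [X in _ + X]/GRing.opp /=.
  by rewrite addrK subrK -mulrBl -intrB addrAC subrr add0r mul1r.
Qed.

Definition sseries_op (g : super_gen) (p : V * V) : V * V :=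
  match g with
  | Even g => (series_op g p.1, series_op g p.2)
  | Theta => (0, p.1)
  | DTheta => (p.2, 0)
  end.

Lemma series_op0 g : series_op g 0 = 0.
Proof. by apply/funext => n; case: g => //=; rewrite /series_op mulr0. Qed.

Lemma sseries_op_lin g : linear (sseries_op g).
Proof.
move=> a [u1 u2] [v1 v2]; case: g => [g||] /=; congr pair => //=;
  by rewrite ?series_op_lin ?scaler0 ?addr0.
Qed.

Lemma sseries_op_rel x y :
  super_rel x y -> eval sseries_op x =1 eval sseries_op y.
Proof.
case=> [||||||g|g] [f1 f2] /=.
- by congr pair; apply: (series_op_rel (weyl_ttinv K)).
- by congr pair; apply: (series_op_rel (weyl_tinvt K)).
- by congr pair; apply: (series_op_rel (weyl_dt K)).
- by congr pair; rewrite /= scale1r ?addr0 ?add0r.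
- by rewrite scale0r.
- by rewrite scale0r.
- by rewrite series_op0.
- by rewrite series_op0.
Qed.

Lemma series1_neq0 : ((fun=> 1) : V) != 0.
Proof. by apply/eqP => /(congr1 (@^~ 0)) /eqP; rewrite oner_eq0. Qed.

Lemma weyl_neq0 : (1 : weyl K) != 0.
Proof. exact: (pact_nontrivial series_op_lin series_op_rel series1_neq0). Qed.

Lemma sweyl_neq0 : (1 : sweyl K) != 0.
Proof.
apply: (pact_nontrivial sseries_op_lin sseries_op_rel
  (v := ((fun=> 1) : V, (fun=> 1) : V))).
by apply/eqP => -[/eqP]; rewrite (negPf series1_neq0).
Qed.

HB.instance Definition _ :=
  GRing.PzSemiRing_isNonZero.Build (weyl K) weyl_neq0.
HB.instance Definition _ :=
  GRing.LSemiModule_isLSemiAlgebra.Build K (weyl K)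
    (@pscalerAl K weyl_gen (@weyl_rel K)).
HB.instance Definition _ :=
  GRing.LSemiAlgebra_isSemiAlgebra.Build K (weyl K)
    (@pscalerAr K weyl_gen (@weyl_rel K)).

HB.instance Definition _ :=
  GRing.PzSemiRing_isNonZero.Build (sweyl K) sweyl_neq0.
HB.instance Definition _ :=
  GRing.LSemiModule_isLSemiAlgebra.Build K (sweyl K)
    (@pscalerAl K super_gen (@super_rel K)).
HB.instance Definition _ :=
  GRing.LSemiAlgebra_isSemiAlgebra.Build K (sweyl K)
    (@pscalerAr K super_gen (@super_rel K)).

End NonTrivial.

Section Generators.
Variable K : comNzRingType.

Definition wgen (g : weyl_gen) : weyl K := pgen (@weyl_rel K) g.
Definition sgen (g : super_gen) : sweyl K := pgen (@super_rel K) g.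

Definition gen_parity (g : super_gen) : bool :=
  if g is Even _ then false else true.

(* The homogeneous components of the superalgebra; [false] stands for even. *)
Inductive sweyl_part : bool -> sweyl K -> Prop :=
| part_gen g : sweyl_part (gen_parity g) (sgen g)
| part_one : sweyl_part false 1
| part_zero b : sweyl_part b 0
| part_add b x y : sweyl_part b x -> sweyl_part b y -> sweyl_part b (x + y)
| part_scale b (a : K) x : sweyl_part b x -> sweyl_part b (a *: x)
| part_mul b c x y :
    sweyl_part b x -> sweyl_part c y -> sweyl_part (b (+) c) (x * y).

End Generators.

Definition irreducible_mod (A : nzRingType) (M : lmodType A) : Prop :=
  (exists v : M, v != 0) /\
  forall U : {pred M}, submod_closed U ->
    (forall v, v \in U -> v = 0) \/ (forall v, v \in U).

Definition isomorphic_mod (A : nzRingType) (M N : lmodType A) : Prop :=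
  exists f : {linear M -> N}, bijective f.

(* A Z/2-graded module: [smod_part false] and [smod_part true] are its even and
   odd parts, K-subspaces of which it is the direct sum. *)
Record smodule (K : comNzRingType) := SModule {
  smod_sort :> lmodType (sweyl K);
  smod_part : bool -> {pred smod_sort};
  smod_part_closed :
    forall b, submod_closed (smod_part b : {pred base_mod smod_sort});
  smod_part_sum : forall v, exists v0 v1,
    [/\ v0 \in smod_part false, v1 \in smod_part true & v = v0 + v1];
  smod_part_direct : forall v,
    v \in smod_part false -> v \in smod_part true -> v = 0;
  smod_part_act : forall b c (x : sweyl K) v,
    sweyl_part b x -> v \in smod_part c -> x *: v \in smod_part (b (+) c)
}.

Arguments smod_part {K} N b : rename.

Definition graded_sub (K : comNzRingType) (N : smodule K) (U : {pred N}) : Prop :=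
  submod_closed U /\
  forall v0 v1, v0 \in smod_part N false -> v1 \in smod_part N true ->
    v0 + v1 \in U -> v0 \in U /\ v1 \in U.

Definition irreducible_smod (K : comNzRingType) (N : smodule K) : Prop :=
  (exists v : N, v != 0) /\
  forall U : {pred N}, graded_sub U ->
    (forall v, v \in U -> v = 0) \/ (forall v, v \in U).

(* The isomorphism is even for [b = false] and odd for [b = true]. *)
Definition isomorphic_smod (K : comNzRingType) (N P : smodule K) : Prop :=
  exists2 f : {linear N -> P}, bijective f &
  exists b : bool, forall c v,
    v \in smod_part N c -> f v \in smod_part P (b (+) c).

Section SConstruction.
Variables (K : comNzRingType) (M : lmodType (weyl K)).

(* The pair [(u, w)] stands for the sum of [u] in M and of the copy of [w] in
   the odd summand. *)
Definition S_pair : Type := (base_mod M * base_mod M)%type.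
HB.instance Definition _ := GRing.Lmodule.on S_pair.

Definition S_op (g : super_gen) (p : S_pair) : S_pair :=
  match g with
  | Even g => (wgen K g *: (p.1 : M), wgen K g *: (p.2 : M))
  | Theta => (0, p.1)
  | DTheta => (p.2, 0)
  end.

Lemma base_linear (x : weyl K) (a : K) (u v : base_mod M) :
  x *: (a *: u + v : M) = (a *: (x *: (u : M) : base_mod M) + x *: (v : M))
    :> base_mod M.
Proof.
rewrite [LHS]scalerDr; congr (_ + _).
have -> : a *: u = (a%:A : weyl K) *: (u : M) by [].
have -> : a *: (x *: (u : M) : base_mod M) = (a%:A : weyl K) *: (x *: (u : M)).
  by [].
by rewrite !scalerA -scalerAl -scalerAr mul1r mulr1.
Qed.

Lemma S_op_lin g : linear (S_op g).
Proof.
move=> a [u1 u2] [v1 v2]; case: g => [g||] /=; congr pair => //=;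
  by rewrite ?base_linear ?scaler0 ?addr0.
Qed.

Lemma wgen_rel : [/\ wgen K WT * wgen K WTinv = 1, wgen K WTinv * wgen K WT = 1
  & wgen K WDt * wgen K WT - wgen K WT * wgen K WDt = 1].
Proof.
split; first by rewrite [LHS]clsM; apply/cls_eq/cong_rel/weyl_ttinv.
  by rewrite [LHS]clsM; apply/cls_eq/cong_rel/weyl_tinvt.
rewrite [_ * wgen K WT]clsM [_ * wgen K WDt]clsM [- _]clsN [LHS]clsD.
by apply/cls_eq/cong_rel/weyl_dt.
Qed.

Lemma S_op_rel x y : super_rel x y -> eval S_op x =1 eval S_op y.
Proof.
have [tt' t't dtt] := wgen_rel.
case=> [||||||g|g] [u w] /=.
- by rewrite !scalerA tt' !(scale1r, scale1r).
- by rewrite !scalerA t't !scale1r.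
- rewrite !scaleN1r scale1r; congr pair => /=;
    by rewrite !scalerA -[_ + _]/(_ - _ : M) -scalerBl dtt scale1r.
- by rewrite scale1r; congr pair; rewrite /= ?addr0 ?add0r.
- by rewrite scale0r.
- by rewrite scale0r.
- by rewrite scaler0.
- by rewrite scaler0.
Qed.

Definition S_space : Type := S_pair.
HB.instance Definition _ := GRing.Zmodule.on S_space.

HB.instance Definition _ :=
  GRing.Zmodule_isLmodule.Build (sweyl K) S_space
    (pactA S_op_lin S_op_rel) (pact1 S_op_lin S_op_rel)
    (pactDr (rels := @super_rel K) S_op_lin) (pactDl S_op_lin S_op_rel).

Lemma weyl_evalE (e : expr K weyl_gen) (p : S_pair) :
  eval S_op (expr_even e) p =
  ((cls (@weyl_rel K) e : weyl K) *: (p.1 : M),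
   (cls (@weyl_rel K) e : weyl K) *: (p.2 : M)).
Proof.
elim: e p => [a|g|x IHx y IHy|x IHx y IHy] p //=.
- have -> : (cls (@weyl_rel K) (Cst a) : weyl K) = a%:A.
    by apply/esym; apply: (mulr1 (cls (@weyl_rel K) (Cst a) : weyl K)).
  by [].
- have <- : (cls (@weyl_rel K) x + cls (@weyl_rel K) y : weyl K)
            = cls (@weyl_rel K) (Add x y) by apply: clsD.
  by rewrite IHx IHy !scalerDl.
- have <- : (cls (@weyl_rel K) x * cls (@weyl_rel K) y : weyl K)
            = cls (@weyl_rel K) (Mul x y) by apply: clsM.
  by rewrite IHy IHx -!scalerA.
Qed.

Lemma S_inclE (x : weyl K) (p : S_space) :
  weyl_incl x *: p = (x *: (p.1 : M), x *: (p.2 : M)).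
Proof.
rewrite [LHS](pact_cls S_op_lin S_op_rel) [LHS]weyl_evalE.
by have -> : cls (@weyl_rel K) (rep x) = x :> weyl K by apply: repK.
Qed.

Definition S_part (b : bool) : {pred S_space} :=
  fun p => if b then p.1 == 0 else p.2 == 0.

Lemma S_genE g (p : S_space) : sgen K g *: p = S_op g p.
Proof. exact: (pact_cls S_op_lin S_op_rel). Qed.

Lemma S_cstE (a : K) (p : S_space) :
  (a%:A : sweyl K) *: p = (a *: (p : S_pair) : S_pair).
Proof.
have -> : (a%:A : sweyl K) = pcst (@super_rel K) a by apply: mulr1.
exact: (pact_cls S_op_lin S_op_rel).
Qed.

Lemma S_part_closed b : submod_closed (S_part b : {pred base_mod S_space}).
Proof.
split; first by case: b; rewrite unfold_in /= eqxx.
move=> a u v; rewrite [a *: u]S_cstE !unfold_in /=.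
by case: b => /eqP u0 /eqP v0; rewrite /= u0 v0 scaler0 addr0.
Qed.

Lemma S_part_sum (v : S_space) : exists v0 v1,
  [/\ v0 \in S_part false, v1 \in S_part true & v = v0 + v1].
Proof.
case: v => u w; exists (u, 0), (0, w); split; rewrite ?unfold_in /= ?eqxx //.
by congr pair; rewrite /= ?addr0 ?add0r.
Qed.

Lemma S_part_direct v : v \in S_part false -> v \in S_part true -> v = 0.
Proof. by case: v => u w; rewrite !unfold_in /= => /eqP -> /eqP ->. Qed.

Lemma S_part_act b c (x : sweyl K) (v : S_space) :
  sweyl_part b x -> v \in S_part c -> x *: v \in S_part (b (+) c).
Proof.
move=> bx; elim: b x / bx c v => [g|||||] => [c v|c v|b c v|b x y _ IHx _ IHy c v|b a x _ IH c v|b d x y _ IHx _ IHy c v] vc.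
- rewrite S_genE; move: vc; case: v => u w; rewrite !unfold_in.
  by case: g c => [g||] [] //= /eqP ->; rewrite /= ?scaler0.
- by rewrite scale1r.
- by rewrite scale0r; have [] := S_part_closed (b (+) c).
- rewrite scalerDl; have [_ /(_ 1)] := S_part_closed (b (+) c).
  move=> /(_ _ _ (IHx _ _ vc) (IHy _ _ vc)); by rewrite scale1r.
- have -> : a *: x = a%:A * x by rewrite -scalerAl mul1r.
  rewrite -scalerA; have [c0 /(_ a)] := S_part_closed (b (+) c).
  by move=> /(_ _ _ (IH _ _ vc) c0); rewrite addr0.
- by rewrite -scalerA -addbA; apply/IHx/IHy.
Qed.

Definition S : smodule K :=
  SModule S_part_closed S_part_sum S_part_direct S_part_act.

End SConstruction.

(* Main.v *)
Require Import Defs.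
From HB Require Import structures.
From mathcomp Require Import all_boot all_order all_algebra.
From mathcomp Require Import reals complex.

(** Write D for the Weyl algebra, SD for the Weyl superalgebra, and theta,
    dtheta for its odd generators. The inverse of M |-> S(M) is
    N |-> ker dtheta. As SD is generated by D, theta and dtheta, and D commutes
    with theta and dtheta, the kernel of dtheta on any SD-module N is a
    D-module. The identity dtheta theta + theta dtheta = 1 gives
    v = dtheta theta v + theta (dtheta v), so that
    v |-> (dtheta theta v, dtheta v) is an isomorphism from N to S(ker dtheta)
    ([decomp_linear], [decomp_bij]); this needs neither the grading nor
    irreducibility.

    The grading matters only when irreducibility is transferred. A
    D-submodule U of ker dtheta corresponds to the SD-submodule U + theta U of
    N, which is graded if U lies in one homogeneous component of N. Hence, when
    N is irreducible, such a U is zero or all of ker dtheta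
    ([ker_homog_submod]). Taking for U the even part of ker dtheta shows that
    ker dtheta lies in a single component of N ([ker_homog]). All its
    submodules are then homogeneous, so it is irreducible, and the isomorphism
    from N to S(ker dtheta) is even or odd according to that component
    ([ker_irreducible], [S_ker_isomorphic]).

    Conversely, a graded submodule of S(M) is determined by its intersection
    with the summand M ([S_irreducible]), and since this summand is the kernel
    of dtheta on S(M), an isomorphism from S(M) to S(N) restricts to one from M
    to N ([S_isomorphic_inv]). *)

Set Implicit Arguments.
Unset Strict Implicit.
Unset Printing Implicit Defensive.

Import GRing.Theory.
Local Open Scope ring_scope.

(** * Preliminaries *)

(** A property of elements of a presented algebra may be checked on scalars and
    generators, and for sums and products. *)
Lemma presented_ind (K : comNzRingType) (G : Type)
    (rels : expr K G -> expr K G -> Prop) (P : presented rels -> Prop) :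
  (forall a, P (pcst rels a)) -> (forall g, P (pgen rels g)) ->
  (forall x y, P x -> P y -> P (x + y)) ->
  (forall x y, P x -> P y -> P (x * y)) -> forall x, P x.
Proof.
move=> Pc Pg PD PM x; rewrite -[x]repK; elim: (rep x) => {x} // x Px y Py.
- by have := PD _ _ Px Py; rewrite [_ + _]clsD.
- by have := PM _ _ Px Py; rewrite [_ * _]clsM.
Qed.

Lemma linear_fun (A : nzRingType) (M N : lmodType A) (f : M -> N) :
  linear f -> exists g : {linear M -> N}, g =1 f.
Proof.
move=> f_lin; pose fL := GRing.isLinear.Build A M N *:%R f f_lin.
by pose g : {linear M -> N} := HB.pack f fL; exists g.
Qed.

(** * The Weyl algebra inside the Weyl superalgebra *)

Section Inclusion.
Variable K : comNzRingType.
Local Notation theta := (sgen K Theta).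
Local Notation dtheta := (sgen K DTheta).
Local Notation incl := (@weyl_incl K).

(** The relations of D hold in SD, so [weyl_incl] does not depend on the chosen
    representatives and is a ring morphism. *)
Lemma cong_expr_even x y :
  cong (@weyl_rel K) x y -> cong (@super_rel K) (expr_even x) (expr_even y).
Proof.
move=> xy; elim: x y / xy => /=; try by move=> *; constructor.
- by move=> x y [] /=; apply: cong_rel; constructor.
- by move=> x y z _ xy _ yz; apply: cong_trans yz.
Qed.

Lemma weyl_incl_cls e :
  incl (cls (@weyl_rel K) e) = cls (@super_rel K) (expr_even e).
Proof. by apply/cls_eq/cong_expr_even/cong_rep. Qed.

Lemma weyl_inclD x y : incl (x + y) = incl x + incl y.
Proof. by rewrite [x + y]/(cls _ _) weyl_incl_cls [RHS]clsD. Qed.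

Lemma weyl_inclM x y : incl (x * y) = incl x * incl y.
Proof. by rewrite [x * y]/(cls _ _) weyl_incl_cls [RHS]clsM. Qed.

Lemma weyl_incl_cst a : incl (pcst (@weyl_rel K) a) = pcst (@super_rel K) a.
Proof. exact: weyl_incl_cls. Qed.

Lemma weyl_incl_gen g : incl (wgen K g) = sgen K (Even g).
Proof. exact: weyl_incl_cls. Qed.

Lemma weyl_incl1 : incl 1 = 1.
Proof. exact: weyl_incl_cst. Qed.

(** SD is generated by D, theta and dtheta. *)
Lemma sweyl_ind (P : sweyl K -> Prop) :
  (forall x, P (incl x)) -> P theta -> P dtheta ->
  (forall x y, P x -> P y -> P (x + y)) ->
  (forall x y, P x -> P y -> P (x * y)) -> forall x, P x.
Proof.
move=> Pi Pt Pd PD PM; apply: presented_ind => //.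
- by move=> a; rewrite -weyl_incl_cst.
- by case=> // g; rewrite -[pgen _ _]weyl_incl_gen.
Qed.

Lemma theta_sqr : theta * theta = 0.
Proof. by rewrite [LHS]clsM; apply/cls_eq/cong_rel; constructor. Qed.

Lemma dtheta_sqr : dtheta * dtheta = 0.
Proof. by rewrite [LHS]clsM; apply/cls_eq/cong_rel; constructor. Qed.

Lemma dtheta_theta : dtheta * theta + theta * dtheta = 1.
Proof.
rewrite [dtheta * _]clsM [theta * _]clsM [LHS]clsD.
by apply/cls_eq/cong_rel; constructor.
Qed.

Lemma weyl_incl_comm (y : sweyl K) :
  (forall g, y * sgen K (Even g) = sgen K (Even g) * y) ->
  forall x, y * incl x = incl x * y.
Proof.
move=> yg; apply: presented_ind => [a|g|x x' Hx Hx'|x x' Hx Hx'].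
- by rewrite weyl_incl_cst; apply/esym/pcstC.
- by rewrite [pgen _ _]/(wgen K g) weyl_incl_gen.
- by rewrite weyl_inclD mulrDr mulrDl Hx Hx'.
- by rewrite weyl_inclM mulrA Hx -mulrA Hx' mulrA.
Qed.

Lemma theta_comm x : theta * incl x = incl x * theta.
Proof.
apply: weyl_incl_comm => g.
by rewrite [LHS]clsM [RHS]clsM; apply/cls_eq/cong_rel; constructor.
Qed.

Lemma dtheta_comm x : dtheta * incl x = incl x * dtheta.
Proof.
apply: weyl_incl_comm => g.
by rewrite [LHS]clsM [RHS]clsM; apply/cls_eq/cong_rel; constructor.
Qed.

Lemma weyl_incl_even x : sweyl_part false (incl x).
Proof.
move: x; apply: presented_ind => [a|g|x y|x y].
- have -> : incl (pcst _ a) = a%:A.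
    by rewrite weyl_incl_cst; apply/esym/(mulr1 (pcst _ a : sweyl K)).
  exact/part_scale/part_one.
- by rewrite [pgen _ _]/(wgen K g) weyl_incl_gen; apply: (part_gen K (Even g)).
- by rewrite weyl_inclD; apply: part_add.
- by rewrite weyl_inclM; apply: (@part_mul _ false false).
Qed.

Lemma sweyl_linear (N P : lmodType (sweyl K)) (f : N -> P) :
  (forall u v, f (u + v) = f u + f v) ->
  (forall x v, f (incl x *: v) = incl x *: f v) ->
  (forall v, f (theta *: v) = theta *: f v) ->
  (forall v, f (dtheta *: v) = dtheta *: f v) -> linear f.
Proof.
move=> fD fi ft fd x u v; rewrite fD; congr (_ + _).
elim/sweyl_ind: x u => [x|||x y IHx IHy|x y IHx IHy] u.
- exact: fi.
- exact: ft.
- exact: fd.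
- by rewrite !scalerDl fD IHx IHy.
- by rewrite -!scalerA IHx IHy.
Qed.

Lemma sweyl_submod (N : lmodType (sweyl K)) (U : {pred N}) :
  0 \in U -> {in U &, forall u v, u + v \in U} ->
  (forall x, {in U, forall v, incl x *: v \in U}) ->
  {in U, forall v, theta *: v \in U} ->
  {in U, forall v, dtheta *: v \in U} -> submod_closed U.
Proof.
move=> U0 UD Ui Ut Ud; split=> // x u v uU vU; apply: (UD) vU.
elim/sweyl_ind: x u uU => [x|||x y IHx IHy|x y IHx IHy] u uU.
- exact: Ui.
- exact: Ut.
- exact: Ud.
- by rewrite scalerDl; apply: UD; [apply: IHx | apply: IHy].
- by rewrite -scalerA; apply/IHx/IHy.
Qed.

End Inclusion.

(** * The functor S on irreducible modules and on isomorphisms *)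

Section Functor.
Variable K : comNzRingType.
Local Notation theta := (sgen K Theta).
Local Notation dtheta := (sgen K DTheta).

Lemma S_irreducible (M : lmodType (weyl K)) :
  irreducible_mod M -> irreducible_smod (S M).
Proof.
move=> [[v v0] M_irr]; split.
  by exists ((v, 0) : S_space M); apply: contraNneq v0 => -[->].
move=> U [U_sub U_gr]; have [U0 UL] := U_sub.
have UZ x (p : S_space M) : p \in U -> x *: p \in U.
  by move=> pU; rewrite -[_ *: p]addr0; apply: UL.
have UD (p q : S_space M) : p \in U -> q \in U -> p + q \in U.
  by move=> pU qU; rewrite -[p]scale1r; apply: UL.
(* the intersection of U with the even summand M *)
pose U1 : {pred M} := [pred u : M | ((u, 0) : S_space M) \in U].
have U1_sub : submod_closed U1.
  split=> // x u w uU wU; rewrite inE.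
  have := UL (weyl_incl x) _ _ uU wU; rewrite S_inclE /= scaler0.
  by rewrite [X in X \in _](_ : _ = (x *: u + w, 0) :> S_space M) //;
    congr pair; rewrite /= addr0.
have odd_even (w : M) : ((0, w) : S_space M) \in U -> w \in U1.
  by move/(UZ dtheta); rewrite S_genE.
have split_pair (u w : M) : ((u, w) : S_space M) = (u, 0) + (0, w).
  by congr pair; rewrite /= ?addr0 ?add0r.
have [U1_0|U1_T] := M_irr _ U1_sub; [left|right] => -[u w].
- rewrite [X in X \in _]split_pair => /U_gr[||uU /odd_even wU].
  + by rewrite unfold_in /= eqxx.
  + by rewrite unfold_in /= eqxx.
  by rewrite (U1_0 _ uU) (U1_0 _ wU).
- rewrite [X in X \in _]split_pair; apply: UD; first exact: U1_T.
  by have := UZ theta _ (U1_T w); rewrite S_genE.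
Qed.

Lemma S_isomorphic (M N : lmodType (weyl K)) :
  isomorphic_mod M N -> isomorphic_smod (S M) (S N).
Proof.
move=> [f [g fK gK]].
pose F (p : S_space M) : S_space N := (f p.1, f p.2).
have F_lin : linear (F : S M -> S N).
  apply: sweyl_linear => [p q|x p|p|p]; rewrite /F.
  - by congr pair; rewrite /= raddfD.
  - by rewrite !S_inclE /= !linearZ.
  - by rewrite !S_genE /= raddf0.
  - by rewrite !S_genE /= raddf0.
have [G GE] := linear_fun F_lin; exists G.
  apply: (@eq_bij _ _ F); last by move=> p; rewrite GE.
  by exists (fun p => (g p.1, g p.2)) => -[u w]; rewrite /F /= ?fK ?gK.
by exists false => c p; rewrite GE !unfold_in; case: c => /eqP /= ->;
  rewrite raddf0.
Qed.

(** The kernel of dtheta on S(M) is the even summand M; this characterises M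
    without reference to the grading. *)
Lemma S_kernel (M : lmodType (weyl K)) (p : S_space M) :
  dtheta *: p = 0 <-> p = (p.1, 0).
Proof.
rewrite S_genE; case: p => u w /=.
by split=> [[->]|[->]].
Qed.

Lemma S_linear_even (M N : lmodType (weyl K)) (F : {linear S M -> S N})
    (u : M) : F (u, 0) = ((F (u, 0)).1, 0).
Proof.
by apply/S_kernel; rewrite -[LHS]linearZ S_genE /= -[RHS](raddf0 F).
Qed.

Lemma S_linear_restr (M N : lmodType (weyl K)) (F : {linear S M -> S N}) :
  linear (fun u : M => (F (u, 0)).1 : N).
Proof.
move=> x u v.
have -> : ((x *: u + v, 0) : S_space M) =
    weyl_incl x *: ((u, 0) : S_space M) + (v, 0).
  by rewrite S_inclE; congr pair; rewrite /= ?scaler0 ?addr0.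
by rewrite linearP S_inclE.
Qed.

Lemma S_isomorphic_inv (M N : lmodType (weyl K)) :
  isomorphic_smod (S M) (S N) -> isomorphic_mod M N.
Proof.
move=> [F [G FK GK] _].
have G_lin : linear G by move=> a u v; apply: (can_inj FK); rewrite linearP !GK.
have [G' GE] := linear_fun G_lin.
have [f fE] := linear_fun (S_linear_restr F).
exists f, (fun w : N => (G' (w, 0)).1) => u.
- by rewrite fE -S_linear_even GE FK.
- by rewrite fE -S_linear_even GE GK.
Qed.

End Functor.

(** * The kernel of dtheta *)

Section Kernel.
Variables (K : comNzRingType) (N : lmodType (sweyl K)).
Local Notation theta := (sgen K Theta).
Local Notation dtheta := (sgen K DTheta).
Local Notation incl := (@weyl_incl K).

(** The kernel of dtheta, as a subset of [N]. *)
Definition dtheta_ker : {pred N} := fun v => dtheta *: v == 0.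

Lemma dtheta_ker_closed : zmod_closed dtheta_ker.
Proof.
split=> [|u v]; rewrite !unfold_in ?scaler0 // => /eqP u0 /eqP v0.
by rewrite scalerBr u0 v0 subr0.
Qed.

HB.instance Definition _ :=
  GRing.isZmodClosed.Build N dtheta_ker dtheta_ker_closed.

(** The kernel of dtheta as a type of its own, to carry its structure of
    D-module. *)
Record ker_space : Type :=
  KerSpace { ker_val :> N; _ : ker_val \in dtheta_ker }.

HB.instance Definition _ := [isSub for ker_val].
HB.instance Definition _ := [Choice of ker_space by <:].
HB.instance Definition _ := [SubChoice_isSubZmodule of ker_space by <:].

Lemma dtheta_kerZ x v : v \in dtheta_ker -> incl x *: v \in dtheta_ker.
Proof.
by rewrite !unfold_in scalerA dtheta_comm -scalerA => /eqP ->; rewrite scaler0.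
Qed.

(** The action of D on the kernel of dtheta, through the inclusion in SD. *)
Definition ker_scale (x : weyl K) (v : ker_space) : ker_space :=
  KerSpace (dtheta_kerZ x (valP v)).

Fact ker_scaleA x y v : ker_scale x (ker_scale y v) = ker_scale (x * y) v.
Proof. by apply: val_inj; rewrite /= scalerA weyl_inclM. Qed.

Fact ker_scale1 : left_id 1 ker_scale.
Proof. by move=> v; apply: val_inj; rewrite /= weyl_incl1 scale1r. Qed.

Fact ker_scaleDr : right_distributive ker_scale +%R.
Proof. by move=> x u v; apply: val_inj; rewrite /= scalerDr. Qed.

Fact ker_scaleDl v : {morph ker_scale^~ v : x y / x + y}.
Proof. by move=> x y; apply: val_inj; rewrite /= weyl_inclD scalerDl. Qed.

HB.instance Definition _ := GRing.Zmodule_isLmodule.Build (weyl K) ker_space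
  ker_scaleA ker_scale1 ker_scaleDr ker_scaleDl.

Lemma ker_valP (v : ker_space) : dtheta *: (v : N) = 0.
Proof. exact/eqP/(valP v). Qed.

Lemma dtheta_in_ker v : dtheta *: v \in dtheta_ker.
Proof. by rewrite unfold_in scalerA dtheta_sqr scale0r. Qed.

(** The action of dtheta, as a map from [N] to the kernel of dtheta. *)
Definition to_ker (v : N) : ker_space := KerSpace (dtheta_in_ker v).

Lemma to_kerD u v : to_ker (u + v) = to_ker u + to_ker v.
Proof. by apply: val_inj; rewrite /= scalerDr. Qed.

Lemma to_kerZ x v : to_ker (incl x *: v) = x *: to_ker v.
Proof. by apply: val_inj; rewrite /= !scalerA dtheta_comm. Qed.

Lemma to_ker0 : to_ker 0 = 0.
Proof. by apply: val_inj; rewrite /= scaler0. Qed.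

Lemma to_ker_val (u : ker_space) : to_ker u = 0.
Proof. by apply: val_inj; rewrite /= ker_valP. Qed.

Lemma to_ker_theta (u : ker_space) : to_ker (theta *: (u : N)) = u.
Proof.
apply: val_inj; rewrite /= scalerA.
by rewrite -[RHS]scale1r -dtheta_theta scalerDl -[X in _ + X]scalerA ker_valP
  scaler0 addr0.
Qed.

(** The isomorphism from [N] to S(ker dtheta): it maps [v] to the pair of
    dtheta theta [v] and dtheta [v]. *)
Definition decomp (v : N) : S_space ker_space :=
  (to_ker (theta *: v), to_ker v).

Lemma decompD u v : decomp (u + v) = decomp u + decomp v.
Proof. by congr pair; rewrite ?scalerDr to_kerD. Qed.

Lemma decomp_linear : linear (decomp : N -> S ker_space).
Proof.
apply: sweyl_linear => [u v|x v|v|v]; first exact: decompD.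
- by rewrite S_inclE /decomp /= scalerA theta_comm -scalerA !to_kerZ.
- by rewrite S_genE /decomp /= scalerA theta_sqr scale0r to_ker0.
- by rewrite S_genE /decomp /= (to_ker_theta (to_ker v)) (to_ker_val (to_ker v)).
Qed.

(** The inverse maps (u, w) to u + theta w. *)
Lemma decomp_bij : bijective decomp.
Proof.
exists (fun p : S_space ker_space => ker_val p.1 + theta *: ker_val p.2).
  by move=> v; rewrite /= !scalerA -scalerDl dtheta_theta scale1r.
move=> [u w]; rewrite /decomp /= scalerDr scalerA theta_sqr scale0r addr0.
by rewrite to_kerD to_ker_val !to_ker_theta add0r.
Qed.

Lemma decomp_val (u : ker_space) : decomp u = (u, 0).
Proof. by rewrite /decomp to_ker_theta to_ker_val. Qed.

(** The set in question is the preimage of S(U) under [decomp], that is,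
    U + theta U. *)
Lemma decomp_submod (U : {pred ker_space}) : submod_closed U ->
  submod_closed [pred v : N | ((decomp v).1 \in U) && ((decomp v).2 \in U)].
Proof.
move=> [U0 UL].
have UD u v : u \in U -> v \in U -> u + v \in U.
  by move=> uU vU; rewrite -[u]scale1r; apply: UL.
have UZ x u : u \in U -> x *: u \in U.
  by move=> uU; rewrite -[_ *: _]addr0; apply: UL.
have dZ x v : decomp (x *: v) = x *: decomp v.
  have := decomp_linear x v 0; rewrite !addr0 => ->.
  by rewrite [decomp 0](_ : _ = 0) ?addr0 // /decomp scaler0 to_ker0.
apply: sweyl_submod => [|u v|x v|v|v]; rewrite !inE.
- by rewrite /decomp /= scaler0 to_ker0 U0.
- rewrite decompD => /andP[u0 u1] /andP[v0 v1].
  by rewrite (UD _ _ u0 v0) (UD _ _ u1 v1).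
- by rewrite dZ S_inclE => /andP[v0 v1]; rewrite !UZ.
- by rewrite dZ S_genE => /andP[v0 v1]; rewrite /= U0.
- by rewrite dZ S_genE => /andP[v0 v1]; rewrite /= U0 andbT.
Qed.

End Kernel.

(** * Gradings and irreducibility *)

Section Graded.
Variables (K : comNzRingType) (N : smodule K).
Local Notation theta := (sgen K Theta).
Local Notation dtheta := (sgen K DTheta).
Local Notation part := (smod_part N).

Lemma part0 b : 0 \in part b.
Proof. by have [] := smod_part_closed N b. Qed.

Lemma partD b u v : u \in part b -> v \in part b -> u + v \in part b.
Proof.
have [_ /(_ 1) L] := smod_part_closed N b => ub vb.
by have := L _ _ ub vb; rewrite scale1r.
Qed.

Lemma partN b v : v \in part b -> - v \in part b.
Proof.
have [_ /(_ (-1)) L] := smod_part_closed N b => vb.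
by have := L _ _ vb (part0 b); rewrite scaleN1r addr0.
Qed.

Lemma part_thetaZ b v : v \in part b -> theta *: v \in part (~~ b).
Proof. exact: (smod_part_act (part_gen K Theta)). Qed.

Lemma part_dthetaZ b v : v \in part b -> dtheta *: v \in part (~~ b).
Proof. exact: (smod_part_act (part_gen K DTheta)). Qed.

Lemma part_disjoint b v : v \in part b -> v \in part (~~ b) -> v = 0.
Proof. by case: b => v0 v1; apply: smod_part_direct. Qed.

(** A homogeneous sum of two elements of opposite parities has a zero term. *)
Lemma part_sum_homog b c u v : u \in part c -> v \in part (~~ c) ->
  u + v \in part b -> u = 0 \/ v = 0.
Proof.
move=> uc vc uvb; have [bc|bc] : b = c \/ b = ~~ c.
  by case: b c {uc vc uvb} => [] []; [left | right | right | left].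
- right; apply: part_disjoint (_ : v \in part c) vc.
  by rewrite -(addKr u v); apply/partD; [apply: partN | rewrite -bc].
- left; apply: part_disjoint uc _.
  by rewrite -(addrK v u); apply/partD; [rewrite -bc | apply: partN].
Qed.

Lemma to_ker_part b v : v \in part b -> ker_val (to_ker v) \in part (~~ b).
Proof. exact: part_dthetaZ. Qed.

Lemma decomp_part b v : v \in part b ->
  ker_val (decomp v).1 \in part b /\ ker_val (decomp v).2 \in part (~~ b).
Proof.
move=> vb; split; last exact: to_ker_part.
by rewrite -[b]negbK; apply/to_ker_part/part_thetaZ.
Qed.

Lemma decomp_graded b (U : {pred ker_space N}) : submod_closed U ->
  {in U, forall v : ker_space N, ker_val v \in part b} ->
  graded_sub [pred v : N | ((decomp v).1 \in U) && ((decomp v).2 \in U)].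
Proof.
move=> U_sub Ub; split; first exact: decomp_submod.
have U_split c (u v : ker_space N) : ker_val u \in part c ->
    ker_val v \in part (~~ c) -> u + v \in U -> u \in U /\ v \in U.
  have [U0 _] := U_sub => uc vc uvU.
  have [e|e] : u = 0 \/ v = 0.
  - by have [e|e] := part_sum_homog uc vc (Ub _ uvU);
      [left | right]; apply: val_inj.
  - by move: uvU; rewrite e add0r.
  - by move: uvU; rewrite e addr0.
move=> v0 v1 /decomp_part[v00 v01] /decomp_part[v10 v11].
rewrite !inE decompD => /andP[].
by move=> /(U_split _ _ _ v00 v10)[-> ->] /(U_split _ _ _ v01 v11)[-> ->].
Qed.

Hypothesis N_irr : irreducible_smod N.

(** Irreducibility of [N] applied to U + theta U. *)
Lemma ker_homog_submod b (U : {pred ker_space N}) : submod_closed U ->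
  {in U, forall v : ker_space N, ker_val v \in part b} ->
  (forall v, v \in U -> v = 0) \/ (forall v, v \in U).
Proof.
move=> U_sub Ub; have [_ /(_ _ (decomp_graded U_sub Ub))] := N_irr.
have [U0 _] := U_sub => -[H|H]; [left|right] => v.
- by move=> vU; apply/val_inj/H; rewrite inE decomp_val vU.
- by have := H v; rewrite inE decomp_val => /andP[].
Qed.

(** The kernel of dtheta on an irreducible [N] lies in one homogeneous
    component. *)
Lemma ker_homog : exists b, forall v : ker_space N, ker_val v \in part b.
Proof.
pose U : {pred ker_space N} := [pred v | ker_val v \in part false].
have U_sub : submod_closed U.
  split=> [|x u v]; rewrite !inE; first exact: part0.
  move=> u0 v0; apply: partD v0.
  exact: (smod_part_act (weyl_incl_even x) u0).
have [//|U0|UT] := @ker_homog_submod false U U_sub; last by exists false.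
(* With no even vector in the kernel, the even component v0 of v vanishes,
   because dtheta v0 and dtheta v1 have opposite parities and sum to zero. *)
exists true => v; have [v0 [v1 [v00 v11 vE]]] := smod_part_sum (ker_val v).
suff v0_ker : v0 \in @dtheta_ker K N.
  have v00E : KerSpace v0_ker = 0 by apply: U0; rewrite inE.
  by rewrite vE [v0](congr1 (@ker_val K N) v00E) add0r.
have dv : dtheta *: v0 + dtheta *: v1 = 0 by rewrite -scalerDr -vE ker_valP.
rewrite unfold_in; apply/eqP.
have : dtheta *: v0 + dtheta *: v1 \in part false by rewrite dv part0.
case/(part_sum_homog (part_dthetaZ v00) (part_dthetaZ v11)) => // d1.
by move: dv; rewrite d1 addr0.
Qed.

Lemma ker_irreducible : irreducible_mod (ker_space N).
Proof.
have [b kb] := ker_homog; split; last first.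
  by move=> U U_sub; apply: (@ker_homog_submod b).
have [[v v0] _] := N_irr.
(* decomp v is nonzero, so one of its two components is *)
have [d10|d1] := eqVneq (to_ker v) 0; last by exists (to_ker v).
exists (to_ker (theta *: v)); apply: contraNneq v0 => d0.
apply/eqP/(bij_inj (@decomp_bij K N)).
by rewrite /decomp scaler0 to_ker0 d0 d10.
Qed.

Lemma S_ker_isomorphic : isomorphic_smod N (S (ker_space N)).
Proof.
have [b kb] := ker_homog.
have [f fE] := linear_fun (@decomp_linear K N); exists f.
  by apply: (@eq_bij _ _ (@decomp K N)) => [|v]; [apply: decomp_bij|rewrite fE].
exists b => c v /decomp_part; rewrite fE => -[d0 d1].
rewrite unfold_in /=; case: ifP => bc; apply/eqP/(@val_inj _ _ (ker_space N)).
- apply: part_disjoint d0 _.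
  by have <- : b = ~~ c by clear -bc; case: b c bc => [] [].
- apply: part_disjoint _ d1.
  by have <- : b = c by clear -bc; case: b c bc => [] [].
Qed.

End Graded.

Theorem proposition3p3 (R : realType) :
  (forall M : lmodType (weyl R[i]),
     irreducible_mod M -> irreducible_smod (S M)) /\
  (forall M N : lmodType (weyl R[i]),
     irreducible_mod M -> irreducible_mod N ->
     (isomorphic_mod M N <-> isomorphic_smod (S M) (S N))) /\
  (forall N : smodule R[i], irreducible_smod N ->
     exists M : lmodType (weyl R[i]),
       irreducible_mod M /\ isomorphic_smod N (S M)).
Proof.
split; first exact: S_irreducible.
split=> [M N _ _|N N_irr].
  by split; [apply: S_isomorphic | apply: S_isomorphic_inv].
exists (ker_space N); split; first exact: ker_irreducible.
exact: S_ker_isomorphic.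
Qed.
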